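(* Let $n\ge 1$. For every completely irrational vector $\boldsymbol{\alpha}\in\mathbb{R}^n$ and every sequence of real numbers $(\sigma_r)_{r\ge 1}$ decreasing to $0$ there exist a continuous function $f:\mathbb{T}^n\to\mathbb{R}$ with zero mean value $\int_{\mathbb{T}^n} f(\boldsymbol{x})\,d\boldsymbol{x}=0$ and a positive integer $t_0$ such that $$\max_{\boldsymbol{x}\in\mathbb{T}^n}|f(\boldsymbol{x})|\le \pi$$ and $$\sum_{k=0}^{t-1} f(k\boldsymbol{\alpha})\ \ge\ t\,\sigma_t\qquad\text{for all integers } t\ge t_0 .$$
   Context: A vector $\boldsymbol{\alpha}=(\alpha_1,\dots,\alpha_n)\in\mathbb{R}^n$ is called completely irrational if $1,\alpha_1,\dots,\alpha_n$ are linearly independent over $\mathbb{Q}$. $\mathbb{T}^n=\mathbb{R}^n/\mathbb{Z}^n$ is the standard torus; functions on $\mathbb{T}^n$ are identified with functions on $\mathbb{R}^n$ that are $1$-periodic in each variable. *)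

(* Defs.v *)
From HB Require Import structures.
From mathcomp Require Import all_boot all_order all_algebra.
From mathcomp Require Import all_classical all_reals all_analysis.

Set Implicit Arguments.
Unset Strict Implicit.
Unset Printing Implicit Defensive.

Import Order.TTheory GRing.Theory Num.Theory.
Import numFieldNormedType.Exports.

Local Open Scope classical_set_scope.
Local Open Scope ring_scope.

(* [free] from [vector] needs a finite-dimensional [vectType], which R is not
   over rat. *)
Definition rat_independent (R : realType) (m : nat) (v : 'rV[R]_m) : Prop :=
  forall q : 'rV[rat]_m, \sum_(i < m) ratr (q 0 i) * v 0 i = 0 -> q = 0.

Definition completely_irrational (R : realType) (n : nat)
    (alpha : 'rV[R]_n) : Prop :=
  rat_independent (row_mx (1%:M : 'M[R]_1) alpha).

(* With [continuous f], a real function on the torus R^n / Z^n. *)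
Definition unit_periodic (R : realType) (n : nat) (f : 'rV[R]_n -> R) : Prop :=
  forall (x : 'rV[R]_n) (i : 'I_n), f (x + delta_mx 0 i) = f x.

Section tuple_measure.
Local Open Scope ereal_scope.
Context d (T : measurableType d) (R : realType) (n : nat).

Definition tuple_cons (p : T * n.-tuple T) : n.+1.-tuple T :=
  [tuple of p.1 :: p.2].

Lemma measurable_tuple_cons : measurable_fun setT tuple_cons.
Proof. exact: (measurable_cons measurable_fst measurable_snd). Qed.

Variables (m : {sigma_finite_measure set T -> \bar R})
          (mu : {sigma_finite_measure set (n.-tuple T) -> \bar R}).

Definition cons_measure : set (n.+1.-tuple T) -> \bar R :=
  pushforward (m \x mu) tuple_cons.

Let cons_measure0 : cons_measure set0 = 0.
Proof. by rewrite /cons_measure /pushforward preimage_set0 measure0. Qed.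

Let cons_measure_ge0 A : 0 <= cons_measure A.
Proof. by rewrite /cons_measure /pushforward; exact: measure_ge0. Qed.

Let cons_measure_semi_sigma_additive : semi_sigma_additive cons_measure.
Proof.
move=> F mF tF mUF; rewrite /cons_measure /pushforward preimage_bigcup.
have mt := measurable_tuple_cons.
apply: measure_semi_sigma_additive.
- by move=> k; rewrite -[X in measurable X]setTI; exact: mt.
- apply/trivIsetP => /= i j _ _ ij; rewrite -preimage_setI.
  by move/trivIsetP : tF => /(_ _ _ _ _ ij) ->//; rewrite preimage_set0.
- by rewrite -preimage_bigcup -[X in measurable X]setTI; exact: mt.
Qed.

HB.instance Definition _ := isMeasure.Build _ _ _ cons_measure
  cons_measure0 cons_measure_ge0 cons_measure_semi_sigma_additive.

Let uncons (t : n.+1.-tuple T) : T * n.-tuple T :=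
  (thead t, [tuple of behead t]).

Let tuple_consK : cancel tuple_cons uncons.
Proof.
move=> [x t]; rewrite /uncons /tuple_cons; congr pair.
exact: val_inj.
Qed.

Let measurable_uncons : measurable_fun setT uncons.
Proof.
apply/measurable_fun_pairP; split.
- exact: measurable_tnth.
- exact: measurable_behead.
Qed.

Let cons_measure_sigma_finite : sigma_finite setT cons_measure.
Proof.
have /sigma_finiteP[F [TF ndF oF]] := sigma_finiteT m.
have /sigma_finiteP[G [TG ndG oG]] := sigma_finiteT mu.
exists (fun k => uncons @^-1` (F k `*` G k)).
  apply/esym; rewrite -preimage_bigcup -subTset => t _ /=.
  have : setT (uncons t).1 by []. rewrite TF => -[i _ Fi].
  have : setT (uncons t).2 by []. rewrite TG => -[j _ Gj].
  exists (maxn i j) => //; split.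
  - by move: Fi; exact/subsetPset/ndF/leq_maxl.
  - by move: Gj; exact/subsetPset/ndG/leq_maxr.
move=> k; have [mFk Fkoo] := oF k; have [mGk Gkoo] := oG k; split.
  by rewrite -[X in measurable X]setTI; apply: measurable_uncons => //;
    exact: measurableX.
rewrite /cons_measure /pushforward -comp_preimage.
rewrite (_ : uncons \o tuple_cons = id) ?preimage_id; last first.
  by apply/funext => p; exact: tuple_consK.
by rewrite product_measure1E// lte_mul_pinfty// ge0_fin_numE.
Qed.

HB.instance Definition _ := Measure_isSigmaFinite.Build _ _ _ cons_measure
  cons_measure_sigma_finite.

End tuple_measure.

(* The n-dimensional Lebesgue measure, as the n-fold product of the
   one-dimensional one.  Tuples carry the product sigma-algebra, whereas row
   vectors carry the topology but no measurable structure. *)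
Fixpoint lebesgue_tuple (R : realType) (n : nat) :
    {sigma_finite_measure set (n.-tuple (measurableTypeR R)) -> \bar R} :=
  if n is k.+1 then cons_measure (@lebesgue_measure R) (lebesgue_tuple R k)
  else \d_ [tuple].

Definition unit_cube (R : realType) (n : nat) :
    set (n.-tuple (measurableTypeR R)) :=
  [set x | forall i, 0 <= (tnth x i : R) <= 1].

Definition torus_integral (R : realType) (n : nat) (f : 'rV[R]_n -> R) :
    \bar R :=
  (\int[lebesgue_tuple R n]_(x in @unit_cube R n)
     (f (\row_i (tnth x i : R)))%:E)%E.

(* Main.v *)
Require Import Defs.
From mathcomp Require Import all_boot all_order all_algebra.
From mathcomp Require Import all_classical all_reals all_analysis.
From mathcomp Require Import measurable_realfun.
From mathcomp Require Import ring lra.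
Set Implicit Arguments.
Unset Strict Implicit.
Unset Printing Implicit Defensive.
Import Order.TTheory GRing.Theory Num.Theory.
Import numFieldNormedType.Exports.
Local Open Scope classical_set_scope.
Local Open Scope ring_scope.

(** The function depends on the first coordinate only, so everything reduces to
    the rotation of the circle by the irrational number a = alpha_1.  Write d
    for the distance to the nearest integer.  For a nonzero integer q put
<<
      h_(q,c)(x) = c / d(qa) * (d(q(x + a)) - d(qx)).
>>
    This is a coboundary, so it has mean value 0 and its Birkhoff sums at the
    point 0 telescope to c * d(tqa) / d(qa).  They are therefore never
    negative, because d is minimal at 0, and they are equal to tc as long as
    t * d(qa) <= 1/2.  Moreover |h_(q,c)| <= c since d is 1-Lipschitz modulo 1.

    Choose a strictly increasing sequence K_m such that sigma_t <= 2^-m for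
    t >= K_m, and nonzero integers q_m with d(q_m a) <= 1 / (2 K_(m+1))
    ([distZ_approx]).  The series g = sum_m h_(q_m, 2^-m) converges uniformly,
    so g is continuous, has mean value 0 and satisfies |g| <= 2 <= pi
    ([coboundary_series]).  If K_m <= t < K_(m+1), the m-th term alone
    contributes t 2^-m >= t sigma_t to the Birkhoff sum and the other terms
    contribute nonnegative amounts.

    The integral over the cube of a function of the first coordinate is
    computed by a change of variables: the first marginal of Lebesgue measure
    on the unit cube is Lebesgue measure on [0, 1]
    ([torus_integral_coord0]). *)

(** * Distance to the nearest integer *)

(** The distance from [x] to the nearest integer; the integer used is the floor
    of [x + 1/2], and [distZ_le] shows that no integer is closer. *)
Definition distZ (R : realType) (x : R) : R :=
  `|x - (Num.floor (x + 2^-1))%:~R|.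

Lemma distZ_ge0 (R : realType) (x : R) : 0 <= distZ x.
Proof. exact: normr_ge0. Qed.

Lemma distZ_le_half (R : realType) (x : R) : distZ x <= 2^-1.
Proof.
rewrite /distZ ler_norml; have := floor_itv (x + 2^-1).
rewrite intrD => /andP[]; lra.
Qed.

(** Distinct integers are at distance at least 1, and [distZ x <= 1/2]. *)
Lemma distZ_le (R : realType) (x : R) (m : int) : distZ x <= `|x - m%:~R|.
Proof.
have [->//|mn] := eqVneq m (Num.floor (x + 2^-1)).
have h := distZ_le_half x.
have : 1 <= `|m%:~R - (Num.floor (x + 2^-1))%:~R| :> R.
  by rewrite -intrB -intr_norm ler1z -gtz0_ge1 normr_gt0 subr_eq0.
have := ler_distD x m%:~R ((Num.floor (x + 2^-1))%:~R : R).
rewrite (distrC m%:~R x) -/(distZ x); lra.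
Qed.

Lemma distZN (R : realType) (x : R) : distZ (- x) = distZ x.
Proof.
suff le_distZN (y : R) : distZ (- y) <= distZ y.
  by apply/eqP; rewrite eq_le le_distZN -{1}(opprK x) le_distZN.
apply: le_trans (distZ_le (- y) (- Num.floor (y + 2^-1))) _.
by rewrite intrN -opprD normrN.
Qed.

Lemma distZ_subadditive (R : realType) (x y : R) :
  distZ (x + y) <= distZ x + distZ y.
Proof.
apply: le_trans (distZ_le _ (Num.floor (x + 2^-1) + Num.floor (y + 2^-1))) _.
by rewrite intrD opprD addrACA ler_normD.
Qed.

(** Modulo the integers, [distZ] is 1-Lipschitz. *)
Lemma distZ_dist (R : realType) (x y : R) :
  `|distZ (x + y) - distZ x| <= distZ y.
Proof.
have := distZ_subadditive x y; have := distZ_subadditive (x + y) (- y).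
rewrite addrK distZN => h1 h2; rewrite ler_norml; apply/andP; split; lra.
Qed.

Lemma distZ_addz (R : realType) (x : R) (m : int) :
  distZ (x + m%:~R) = distZ x.
Proof.
have m0 : distZ (m%:~R : R) = 0.
  apply/eqP; rewrite eq_le distZ_ge0 andbT.
  by apply: le_trans (distZ_le _ m) _; rewrite subrr normr0.
by apply/eqP; rewrite -subr_eq0 -normr_le0 -m0 distZ_dist.
Qed.

Lemma distZ_small (R : realType) (x : R) : `|x| <= 2^-1 -> distZ x = `|x|.
Proof.
move=> x_small; apply/eqP; rewrite eq_le.
have -> /= : distZ x <= `|x| by have := distZ_le x 0; rewrite subr0.
rewrite /distZ; set m := Num.floor _.
have [->|m0] := eqVneq m 0; first by rewrite subr0.
have : 1 <= `|m%:~R| :> R by rewrite -intr_norm ler1z -gtz0_ge1 normr_gt0.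
have := ler_distD x 0 (m%:~R : R).
rewrite !sub0r !normrN; lra.
Qed.

Lemma distZ_muln (R : realType) (x : R) (t : nat) :
  t%:R * distZ x <= 2^-1 -> distZ (t%:R * x) = t%:R * distZ x.
Proof.
move=> tx; set m := Num.floor (x + 2^-1).
have -> : t%:R * x = t%:R * (x - m%:~R) + (t%:Z * m)%:~R.
  by rewrite intrM mulrBr subrK.
rewrite distZ_addz distZ_small normrM normr_nat //.
Qed.

Lemma continuous_distZ (R : realType) : continuous (@distZ R).
Proof.
move=> x; apply/cvgrPdist_lt => e e0; near=> y.
have := distZ_dist y (x - y); rewrite subrKC => /le_lt_trans; apply.
have := distZ_le (x - y) 0; rewrite subr0 => /le_lt_trans; apply.
by near: y; apply: cvgr_dist_lt.
Unshelve. all: by end_near. Qed.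

(** If [th] is [q * a] reduced modulo 1 to [-1/2, 1/2] and [k] is the integer
    nearest to [1 / th], then [k * th] lies within [`|th| / 2] of 1, so that
    [k * q] is the multiplier sought. *)
Lemma distZ_halving (R : realType) (a : R) (q : int) :
  distZ (q%:~R * a) != 0 -> q != 0 ->
  exists2 r : int, r != 0 & distZ (r%:~R * a) <= distZ (q%:~R * a) / 2.
Proof.
move=> qa0 q0; set p := Num.floor (q%:~R * a + 2^-1).
pose th := q%:~R * a - p%:~R.
have th0 : th != 0 by rewrite -normr_eq0.
have thE : `|th| = distZ (q%:~R * a) by [].
pose k := Num.floor (th^-1 + 2^-1).
have kth : `|th^-1 - k%:~R| <= 2^-1 := distZ_le_half th^-1.
have k0 : k != 0.
  apply/eqP => kE; move: kth; rewrite kE subr0 normfV.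
  rewrite lef_pV2 ?posrE ?normr_gt0// thE.
  by have := distZ_le_half (q%:~R * a); lra.
exists (k * q); first by rewrite mulf_neq0.
apply: le_trans (distZ_le _ (k * p + 1)) _.
have -> : (k * q)%:~R * a - (k * p + 1)%:~R = - (th * (th^-1 - k%:~R)).
  rewrite mulrBr mulfV // /th intrD !intrM; ring.
rewrite normrN normrM -thE ler_pM2l ?normr_gt0//.
Qed.

(** Dirichlet approximation without a rate, by iterating [distZ_halving]. *)
Lemma distZ_approx (R : realType) (a : R)
    (a_irr : forall q : int, q != 0 -> distZ (q%:~R * a) != 0) (e : R) :
  0 < e -> exists2 q : int, q != 0 & distZ (q%:~R * a) <= e.
Proof.
move=> e0.
have step n : exists2 q : int, q != 0 & distZ (q%:~R * a) <= 2^-1 ^+ n.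
  elim: n => [|n [q q0 IH]].
    exists 1 => //; apply: le_trans (distZ_le_half _) _.
    by rewrite expr0; lra.
  have [r r0 hr] := distZ_halving (a_irr q q0) q0.
  exists r => //; apply: le_trans hr _.
  by rewrite exprSr ler_pM2r.
have : (geometric 1 (2^-1 : R)) @ \oo --> 0.
  by apply: cvg_geometric; rewrite ger0_norm; lra.
move=> /cvgrPdist_le/(_ e e0)[n _ /(_ n (leqnn n))/=].
rewrite sub0r normrN mul1r ger0_norm ?exprn_ge0// => hn.
have [q q0 hq] := step n; exists q => //; exact: le_trans hq hn.
Qed.

(** * Integrals of periodic functions *)

Lemma Rintegral_shift (R : realType) (v : R -> R) (v_cont : continuous v)
    (s a b : R) : a <= b ->
  \int[@lebesgue_measure R]_(x in `[a, b]) v (x + s) =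
  \int[@lebesgue_measure R]_(x in `[a + s, b + s]) v x.
Proof.
move=> ab.
have dF : derive1 (fun x : R => x + s) = cst 1.
  apply/funext => x; rewrite derive1E.
  exact: (congr1 (@^~ x) (@derive_shift R 1 s)).
rewrite /Rintegral; congr fine.
rewrite (@integration_by_substitution_increasing _ (fun x : R => x + s)
  v a b) //.
- by apply: eq_integral => x _; rewrite /= fctE /= dF /= mulr1.
- by move=> x y _ _ xy; rewrite ltrD2r.
- by rewrite dF => x _; exact: cvg_cst.
- by rewrite dF; exact: is_cvg_cst.
- by rewrite dF; exact: is_cvg_cst.
- have sc : continuous (fun x : R => x + s).
    by move=> x; apply: cvgD; [exact: cvg_id|exact: cvg_cst].
  split.
  + by move=> x _; case: (@is_derive_shift R x 1 s).
  + by apply: cvg_at_right_filter; exact: sc.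
  + by apply: cvg_at_left_filter; exact: sc.
- exact: continuous_subspaceT.
Qed.

Lemma continuous_itv_integrable (R : realType) (v : R -> R) (a b : R) :
  continuous v -> (@lebesgue_measure R).-integrable `[a, b] (EFin \o v).
Proof.
move=> v_cont; apply: continuous_compact_integrable.
  exact: segment_compact.
exact: continuous_subspaceT.
Qed.

Lemma Rintegral_itv_split (R : realType) (v : R -> R) (v_cont : continuous v)
    (a b c : R) : a <= b -> b <= c ->
  \int[@lebesgue_measure R]_(x in `[a, c]) v x =
  \int[@lebesgue_measure R]_(x in `[a, b]) v x +
  \int[@lebesgue_measure R]_(x in `[b, c]) v x.
Proof.
move=> ab bc; apply/eqP; rewrite addrC -subr_eq; apply/eqP.
rewrite Rintegral_itvB ?bnd_simp//; last exact: continuous_itv_integrable.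
apply: Rintegral_itv_obnd_cbnd.
apply: (integrableS _ _ _ (continuous_itv_integrable b c v_cont)) => //.
exact: subset_itv_oc_cc.
Qed.

Lemma Rintegral_periodic_shift (R : realType) (v : R -> R)
    (v_cont : continuous v) (v_per : forall x, v (x + 1) = v x) (s : R) :
  \int[@lebesgue_measure R]_(x in `[0, 1]) v (x + s) =
  \int[@lebesgue_measure R]_(x in `[0, 1]) v x.
Proof.
have v_perN (n : nat) x : v (x + n%:R) = v x.
  by elim: n x => [|n IH] x; rewrite ?addr0// -natr1 addrA v_per.
have v_perz (m : int) x : v (x + m%:~R) = v x.
  case: m => n; first exact: v_perN.
  by rewrite NegzE intrN -[in RHS](subrK n.+1%:R x) v_perN.
(* By periodicity the shift may be taken in [0, 1). *)
pose r := s - (Num.floor s)%:~R.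
have rE : forall x, v (x + s) = v (x + r).
  by move=> x; rewrite -(v_perz (- Num.floor s)) -addrA intrN.
under eq_Rintegral do rewrite rE.
have /andP[] := floor_itv s; rewrite intrD => r0 r1.
have {}r0 : 0 <= r by rewrite subr_ge0.
have {}r1 : r <= 1 by rewrite /r; lra.
rewrite Rintegral_shift // add0r.
rewrite (@Rintegral_itv_split _ v v_cont r 1 (1 + r)) //; last by lra.
have <- : \int[@lebesgue_measure R]_(x in `[0, r]) v (x + 1) =
          \int[@lebesgue_measure R]_(x in `[1, 1 + r]) v x.
  by rewrite Rintegral_shift // add0r (addrC r).
under [X in _ + X]eq_Rintegral do rewrite v_per.
by rewrite addrC -Rintegral_itv_split.
Qed.

(** * Series dominated by powers of 1/2 *)

Lemma half_pow_series_tail (R : realType) (h : nat -> R)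
    (h_le : forall m, `|h m| <= 2^-1 ^+ m) :
  cvgn (series h) /\
  forall M, `|limn (series h) - series h M| <= 2 * 2^-1 ^+ M.
Proof.
have half1 : `|2^-1| < 1 :> R by rewrite ger0_norm; lra.
have h_le' m : `|h m| <= geometric 1 2^-1 m by rewrite /= mul1r.
have cvg_h : cvgn (series h).
  apply: normed_cvg; apply: (series_le_cvg _ _ h_le').
  - by move=> n; exact: normr_ge0.
  - by move=> n; rewrite geometric_ge0.
  - exact: is_cvg_geometric_series.
split=> // M.
have cvg_dist : `|series h n - series h M| @[n --> \oo] -->
    `|limn (series h) - series h M|.
  by apply: cvg_norm; apply: cvgB => //; exact: cvg_cst.
apply: (ler_cvg_to cvg_dist (cvg_cst _)); near=> N.
have MN : (M <= N)%N by near: N; exists M.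
rewrite sub_series MN; apply: le_trans (ler_norm_sum _ _ _) _.
apply: le_trans (ler_sum _ (fun i _ => h_le' i)) _.
rewrite -(subnKC MN) -mulr_sumr geometric_partial_tail mul1r.
apply: le_trans (geometric_le_lim _ _ _ half1) _ => //.
have -> : 1 - 2^-1 = 2^-1 :> R by lra.
by rewrite invrK mulrC.
Unshelve. all: by end_near. Qed.

Lemma exists_half_pow_le (R : realType) (e : R) : 0 < e ->
  exists M, 2 * 2^-1 ^+ M <= e.
Proof.
move=> e0.
have : (geometric 2 (2^-1 : R)) @ \oo --> 0.
  by apply: cvg_geometric; rewrite ger0_norm; lra.
move=> /cvgrPdist_le/(_ e e0)[M _ /(_ M (leqnn M))/=].
rewrite sub0r normrN ger0_norm; first by exists M.
by rewrite mulr_ge0 // exprn_ge0.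
Qed.

Lemma continuous_series (R : realType) (h : nat -> R -> R)
    (h_cont : forall m, continuous (h m)) (M : nat) :
  continuous (fun x => series (h ^~ x) M).
Proof.
elim: M => [|M IH] x; rewrite /series /=.
  by under eq_fun do rewrite big_nil; exact: cvg_cst.
under eq_fun do rewrite big_nat_recr//=.
by apply: continuousD; [exact: IH|exact: h_cont].
Qed.

Lemma continuous_lim_series (R : realType) (h : nat -> R -> R)
    (h_cont : forall m, continuous (h m))
    (h_le : forall m x, `|h m x| <= 2^-1 ^+ m) :
  continuous (fun x => limn (series (h ^~ x))).
Proof.
move=> x; apply/cvgrPdist_lt => e e0.
have e30 : 0 < e / 3 by rewrite divr_gt0.
have [M hM] := exists_half_pow_le e30.
have tail y := (half_pow_series_tail (h_le ^~ y)).2 M.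
near=> y.
have : `|series (h ^~ x) M - series (h ^~ y) M| < e / 3.
  near: y.
  by move: (@continuous_series _ h h_cont M x) => /cvgrPdist_lt/(_ _ e30).
have := tail x; have := tail y.
move=> /le_trans/(_ hM) + /le_trans/(_ hM).
rewrite !ler_norml !ltr_norml => /andP[? ?] /andP[? ?] /andP[? ?].
by apply/andP; split; lra.
Unshelve. all: by end_near. Qed.

(** * The first marginal of Lebesgue measure on the unit cube *)

Lemma preimage_tuple_cons_unit_cube (R : realType) (n : nat) :
  @tuple_cons _ (measurableTypeR R) n @^-1` (@unit_cube R n.+1) =
  `[0, 1]%classic `*` @unit_cube R n.
Proof.
apply/seteqP; split=> -[x t] /=.
  move=> h; split; first by have := h ord0; rewrite /= in_itv.
  by move=> i; have := h (lift ord0 i); rewrite tnthS.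
move=> [/= hx ht] i; case: (unliftP ord0 i) => [j ->|->].
  by rewrite tnthS; exact: ht.
by move: hx; rewrite in_itv.
Qed.

Lemma measurable_unit_cube (R : realType) (n : nat) :
  measurable (@unit_cube R n).
Proof.
have -> : @unit_cube R n = \bigcap_(i in [set: 'I_n])
    ((fun x : n.-tuple (measurableTypeR R) => tnth x i) @^-1` `[0, 1]%classic).
  apply/seteqP; split=> x /= h i.
    by move=> _ /=; rewrite in_itv; exact: h.
  by have := h i Logic.I; rewrite /= in_itv.
apply: fin_bigcap_measurable => [|i _]; first exact: finite_finset.
rewrite -[X in measurable X]setTI; exact: measurable_tnth.
Qed.

Lemma lebesgue_tuple_unit_cube (R : realType) (n : nat) :
  lebesgue_tuple R n (@unit_cube R n) = 1%E.
Proof.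
elim: n => [|n IH] /=.
  by rewrite diracE mem_set // => -[].
rewrite /cons_measure /pushforward preimage_tuple_cons_unit_cube.
rewrite product_measure1E //.
  rewrite IH mule1; apply: etrans (lebesgue_measure_itv `[0, 1]) _.
  by rewrite /= lte_fin ltr01 oppr0 adde0.
exact: measurable_unit_cube.
Qed.

(** Integrating against the restriction of [mu] to [C] amounts to integrating
    over [C]. *)
Lemma integral_mrestr (d : measure_display) (T : measurableType d)
    (R : realType) (mu : {measure set T -> \bar R}) (C D : set T)
    (mC : measurable C) (f : T -> \bar R) :
  measurable D -> C `<=` D -> (mrestr mu mC).-integrable D f ->
  (\int[mrestr mu mC]_(x in D) f x = \int[mu]_(x in C) f x)%E.
Proof.
move=> mD CD intf.
have null : mrestr mu mC (~` C) = 0%E by rewrite /mrestr setICl measure0.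
rewrite (negligible_integral (measurableC mC) mD intf null).
rewrite setDE setCK (setIidr CD).
by apply: eq_measure_integral => A mA AC; rewrite /= /mrestr setIidl.
Qed.

Lemma torus_integral_coord0 (R : realType) (n : nat) (g : R -> R) :
  continuous g ->
  torus_integral (fun x : 'rV[R]_n.+1 => g (x 0 0)) =
  (\int[@lebesgue_measure R]_(x in `[0%R, 1%R]) (g x)%:E)%E.
Proof.
move=> g_cont; rewrite /torus_integral.
set mu := lebesgue_tuple R n.+1; set C := @unit_cube R n.+1.
have mC : measurable C := @measurable_unit_cube R n.+1.
have mg0 : measurable_fun setT g by exact: continuous_measurable_fun.
have mg : measurable_fun setT (EFin \o g) by exact/measurable_EFinP.
pose phi := fun t : n.+1.-tuple (measurableTypeR R) => tnth t ord0.
have mphi : measurable_fun setT phi by exact: measurable_tnth.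
pose I01 : set (measurableTypeR R) := `[0, 1]%classic.
have mI : measurable I01 by exact: measurable_itv.
have mPI : measurable (phi @^-1` I01).
  by rewrite -[X in measurable X]setTI; exact: mphi.
have CI : C `<=` phi @^-1` I01.
  by move=> x /(_ ord0); rewrite /= /I01 /= in_itv.
have int_phi : (mrestr mu mC).-integrable (phi @^-1` I01) (EFin \o (g \o phi)).
  apply: measurable_bounded_integrable => //.
  - by rewrite /= /mrestr setIidr // lebesgue_tuple_unit_cube ltry.
  - apply: measurable_funTS; exact: (measurableT_comp mg0 mphi).
  - have /compact_bounded[M [Mreal HM]] : compact (g @` `[0, 1]).
      apply: continuous_compact; last exact: segment_compact.
      exact: continuous_subspaceT.
    by exists M; split=> // e /HM Me x /= Ix; apply: Me; exists (phi x).
(* The restriction of [mu] to the cube allows the cube to be replaced by the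
   cylinder [phi @^-1` I01], as the change of variables requires. *)
transitivity
  (\int[mrestr mu mC]_(x in phi @^-1` I01) (EFin \o (g \o phi)) x)%E.
  rewrite (integral_mrestr mPI CI int_phi).
  by apply: eq_integral => x _; rewrite mxE.
rewrite -[LHS](integral_pushforward mphi mg) //.
apply: eq_measure_integral => A mA AI /=.
rewrite /pushforward /mrestr /mu /=.
rewrite /cons_measure /pushforward preimage_setI /C.
rewrite preimage_tuple_cons_unit_cube.
have -> : @tuple_cons _ (measurableTypeR R) n @^-1` (phi @^-1` A)
    `&` (`[0, 1]%classic `*` @unit_cube R n) = A `*` @unit_cube R n.
  apply/seteqP; split=> -[x t] /=; rewrite /phi /=.
    by move=> [Ax [_ Ct]].
  by move=> [Ax Ct]; split=> //; split=> //; exact: AI.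
rewrite product_measure1E //; last exact: measurable_unit_cube.
by rewrite lebesgue_tuple_unit_cube mule1.
Qed.

(** * Coboundaries of the rotation *)

(** If [distZ (q * a)] vanished, then [q * a] would be an integer [p], and
    [- p * 1 + q * a = 0] would be a rational relation. *)
Lemma completely_irrational_distZ_neq0 (R : realType) (n : nat)
    (alpha : 'rV[R]_n) (halpha : completely_irrational alpha) (i : 'I_n)
    (q : int) :
  q != 0 -> distZ (q%:~R * alpha 0 i) != 0.
Proof.
move=> q0; apply/eqP => /eqP; rewrite normr_eq0 subr_eq0 => /eqP qa.
set p := Num.floor _ in qa.
pose c : 'rV[rat]_(1 + n) := row_mx (- p%:~R)%:M (q%:~R *: delta_mx 0 i).
have /halpha/rowP/(_ (rshift 1 i)) :
    \sum_(j < 1 + n) ratr (c 0 j) * (row_mx (1%:M : 'M[R]_1) alpha) 0 j = 0.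
  rewrite big_split_ord /= big_ord1 !row_mxEl !mxE /= !mulr1n mulr1.
  rewrite (bigD1 i) //= big1 => [|j ji]; last first.
    by rewrite !row_mxEr !mxE eqxx /= (negPf ji) mulr0 rmorph0 mul0r.
  rewrite !row_mxEr !mxE !eqxx mulr1 addr0 rmorphN /= !ratr_int qa; lra.
rewrite row_mxEr !mxE !eqxx mulr1 => /eqP.
by rewrite intr_eq0 (negPf q0).
Qed.

(** The coboundary [u (x + a) - u x] of the rotation by [a], where [u x] is
    [distZ (q * x)] scaled by [c / distZ (q * a)].  The scaling makes [c] a
    bound for it, provided that [distZ (q * a)] is nonzero. *)
Definition coboundary (R : realType) (a : R) (q : int) (c x : R) : R :=
  c / distZ (q%:~R * a) *
  (distZ (q%:~R * (x + a)) - distZ (q%:~R * x)).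

Lemma continuous_distZ_mul (R : realType) (q : int) (s : R) :
  continuous (fun x => distZ (q%:~R * (x + s))).
Proof.
move=> x; apply: (@continuous_comp _ _ _ (fun x => q%:~R * (x + s)) (@distZ R)).
  apply: cvgM; first exact: cvg_cst.
  by apply: cvgD; [exact: cvg_id|exact: cvg_cst].
exact: continuous_distZ.
Qed.

Lemma distZ_mul_periodic (R : realType) (q : int) (x : R) :
  distZ (q%:~R * (x + 1)) = distZ (q%:~R * x).
Proof. by rewrite mulrDr mulr1 distZ_addz. Qed.

Lemma coboundary_periodic (R : realType) (a : R) (q : int) (c x : R) :
  coboundary a q c (x + 1) = coboundary a q c x.
Proof. by rewrite /coboundary addrAC !distZ_mul_periodic. Qed.

Lemma continuous_distZ_mul0 (R : realType) (q : int) :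
  continuous (fun x : R => distZ (q%:~R * x)).
Proof.
have -> : (fun x : R => distZ (q%:~R * x)) = fun x => distZ (q%:~R * (x + 0)).
  by apply/funext => x; rewrite addr0.
exact: continuous_distZ_mul.
Qed.

Lemma continuous_coboundary (R : realType) (a : R) (q : int) (c : R) :
  continuous (coboundary a q c).
Proof.
move=> x; apply: cvgM; first exact: cvg_cst.
apply: cvgB; first exact: continuous_distZ_mul.
exact: continuous_distZ_mul0.
Qed.

Lemma coboundary_bounded (R : realType) (a : R) (q : int) (c x : R) :
  0 <= c -> distZ (q%:~R * a) != 0 -> `|coboundary a q c x| <= c.
Proof.
move=> c0 d0; have dp : 0 < distZ (q%:~R * a) by rewrite lt0r d0 distZ_ge0.
rewrite /coboundary normrM ger0_norm ?divr_ge0 ?distZ_ge0 // mulrAC.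
rewrite ler_pdivrMr //.
by rewrite ler_wpM2l // mulrDr distZ_dist.
Qed.

Lemma Rintegral_coboundary (R : realType) (a : R) (q : int) (c : R) :
  \int[@lebesgue_measure R]_(x in `[0, 1]) coboundary a q c x = 0.
Proof.
pose v := fun x : R => distZ (q%:~R * x).
have v_cont : continuous v by exact: continuous_distZ_mul0.
have va_cont : continuous (fun x => v (x + a)) by exact: continuous_distZ_mul.
rewrite /coboundary RintegralZl //; last first.
  apply: (@continuous_itv_integrable R (fun x => v (x + a) - v x)).
  by move=> x; apply: cvgB; [exact: va_cont|exact: v_cont].
transitivity (c / distZ (q%:~R * a) *
    (\int[@lebesgue_measure R]_(x in `[0, 1]) v (x + a) -
     \int[@lebesgue_measure R]_(x in `[0, 1]) v x)).
  by congr (_ * _); apply: RintegralB => //; exact: continuous_itv_integrable.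
rewrite Rintegral_periodic_shift //; first by rewrite subrr mulr0.
by move=> x; exact: distZ_mul_periodic.
Qed.

(** The Birkhoff sum telescopes, and [u 0 = 0]. *)
Lemma coboundary_birkhoff (R : realType) (a : R) (q : int) (c : R) (t : nat) :
  \sum_(0 <= k < t) coboundary a q c (k%:R * a) =
  c / distZ (q%:~R * a) * distZ (t%:R * (q%:~R * a)).
Proof.
rewrite /coboundary -mulr_sumr; congr (_ * _).
pose u k := distZ (k%:R * (q%:~R * a) : R).
rewrite (eq_bigr (fun k => u k.+1 - u k)) => [|k _]; last first.
  by rewrite /u !(mulrCA _ (q%:~R)) -natr1 mulrDl mul1r.
by rewrite telescope_sumr // /u mul0r [X in _ - X]distZ_small ?normr0 ?subr0 //.
Qed.

Lemma coboundary_birkhoff_ge0 (R : realType) (a : R) (q : int) (c : R)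
    (t : nat) :
  0 <= c -> 0 <= \sum_(0 <= k < t) coboundary a q c (k%:R * a).
Proof.
by move=> c0; rewrite coboundary_birkhoff mulr_ge0 ?divr_ge0 ?distZ_ge0.
Qed.

Lemma coboundary_birkhoff_linear (R : realType) (a : R) (q : int) (c : R)
    (t : nat) :
  distZ (q%:~R * a) != 0 -> t%:R * distZ (q%:~R * a) <= 2^-1 ->
  \sum_(0 <= k < t) coboundary a q c (k%:R * a) = t%:R * c.
Proof.
move=> d0 td; rewrite coboundary_birkhoff distZ_muln //.
by rewrite mulrCA divfK.
Qed.

(** The Birkhoff sum of the m-th term equals [t * 2 ^- m] up to the time
    [1 / (2 * distZ (q m * a))], and the Birkhoff sums of the other terms are
    nonnegative, hence the last clause. *)
Lemma coboundary_series (R : realType) (a : R)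
    (a_irr : forall q : int, q != 0 -> distZ (q%:~R * a) != 0)
    (q : nat -> int) (q_neq0 : forall m, q m != 0)
    (g := fun x : R =>
       limn (series (fun m => coboundary a (q m) (2^-1 ^+ m) x))) :
  [/\ continuous g, forall x, g (x + 1) = g x,
      \int[@lebesgue_measure R]_(x in `[0, 1]) g x = 0,
      forall x, `|g x| <= 2 &
      forall m t, t%:R * distZ ((q m)%:~R * a) <= 2^-1 ->
        t%:R * 2^-1 ^+ m <= \sum_(0 <= k < t) g (k%:R * a)].
Proof.
pose h m := coboundary a (q m) (2^-1 ^+ m).
have c_ge0 m : 0 <= (2^-1 : R) ^+ m by exact: exprn_ge0.
have h_le m x : `|h m x| <= 2^-1 ^+ m.
  by apply: coboundary_bounded; rewrite ?a_irr.
have h_cont m : continuous (h m) by exact: continuous_coboundary.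
have g_cont : continuous g by exact: continuous_lim_series.
have tail x := (half_pow_series_tail (h_le ^~ x)).2.
have g_cvg x : series (h ^~ x) @ \oo --> g x.
  by have [] := half_pow_series_tail (h_le ^~ x).
split=> //.
- move=> x; rewrite /g; congr (limn (series _)).
  by apply/funext => m; exact: coboundary_periodic.
- have int_series M : \int[@lebesgue_measure R]_(x in `[0, 1])
      series (h ^~ x) M = 0.
    elim: M => [|M IH].
      under eq_Rintegral do rewrite /series /= big_nil.
      by rewrite Rintegral_cst // mul0r.
    under eq_Rintegral do rewrite seriesSr.
    rewrite RintegralD //; last 2 first.
    + by apply: continuous_itv_integrable; exact: continuous_series.
    + exact: continuous_itv_integrable.
    by rewrite IH Rintegral_coboundary addr0.
  (* The partial sums have integral 0 and approximate [g] uniformly. *)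
  apply/eqP; rewrite -normr_le0; apply/ler_addgt0Pl => e e0; rewrite addr0.
  have [M hM] := exists_half_pow_le e0.
  have s_cont : continuous (fun x => series (h ^~ x) M).
    exact: continuous_series.
  have -> : \int[@lebesgue_measure R]_(x in `[0, 1]) g x =
      \int[@lebesgue_measure R]_(x in `[0, 1]) (g x - series (h ^~ x) M).
    rewrite RintegralB //; first by rewrite int_series subr0.
    - exact: continuous_itv_integrable.
    - exact: continuous_itv_integrable.
  have d_cont : continuous (fun x => g x - series (h ^~ x) M).
    by move=> x; apply: cvgB; [exact: g_cont|exact: s_cont].
  apply: le_trans (le_normr_Rintegral _ _) _ => //.
    exact: continuous_itv_integrable.
  apply: (@le_trans _ _ (\int[@lebesgue_measure R]_(x in `[0, 1]) e)).
    apply: le_Rintegral => //.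
    + apply: continuous_itv_integrable => x.
      by apply: cvg_norm; exact: d_cont.
    + by apply: continuous_itv_integrable => x; exact: cvg_cst.
    + by move=> x _; apply: le_trans (tail x M) hM.
  rewrite Rintegral_cst // [X in _ * fine X](_ : _ = 1%E) ?mulr1 //.
  apply: etrans (lebesgue_measure_itv `[0, 1]) _.
  by rewrite /= lte_fin ltr01 oppr0 adde0.
- move=> x; have := tail x 0%N.
  by rewrite /series /= big_nil subr0 expr0 mulr1.
- move=> m t tm.
  have sum_cvg : \sum_(0 <= k < t) series (h ^~ (k%:R * a)) M @[M --> \oo] -->
      \sum_(0 <= k < t) g (k%:R * a).
    elim: t {tm} => [|t IH].
      by under eq_fun do rewrite big_nil; rewrite big_nil; exact: cvg_cst.
    under eq_fun do rewrite big_nat_recr //=.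
    by rewrite big_nat_recr //=; apply: cvgD IH (g_cvg _).
  apply: (ler_cvg_to (cvg_cst _) sum_cvg); near=> M.
  have mM : (m < M)%N by near: M; exists m.+1.
  rewrite /series /= exchange_big_nat /= big_mkord (bigD1 (Ordinal mM)) //=.
  rewrite coboundary_birkhoff_linear ?a_irr // lerDl; apply: sumr_ge0 => i _.
  exact: coboundary_birkhoff_ge0.
Unshelve. all: by end_near. Qed.

(** * Choice of the frequencies *)

Lemma exists_block (K : nat -> nat) (t : nat) :
  (forall m, (m < K m)%N) -> (K 0 <= t)%N ->
  exists m, (K m <= t < K m.+1)%N.
Proof.
move=> K_gt K0t.
have ex_m : exists m, (t < K m.+1)%N by exists t; apply: ltn_trans (K_gt _).
have [m tm m_min] := ex_minnP ex_m.
exists m; rewrite tm andbT; case: m tm m_min => [//|m] _ m_min.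
by rewrite leqNgt; apply/negP => /m_min; rewrite ltnn.
Qed.

Theorem theorem1 (R : realType) (n : nat) (hn : (1 <= n)%N)
    (alpha : 'rV[R]_n) (halpha : completely_irrational alpha)
    (sigma : nat -> R)
    (hdecr : forall r s : nat, (1 <= r)%N -> (r <= s)%N -> sigma s <= sigma r)
    (hlim : sigma @ \oo --> (0 : R)) :
  exists (f : 'rV[R]_n -> R) (t0 : nat),
    [/\ continuous f,
        unit_periodic f,
        torus_integral f = 0%:E,
        (forall x : 'rV[R]_n, `|f x| <= pi) &
        (0 < t0)%N /\
        forall t : nat, (t0 <= t)%N ->
          \sum_(0 <= k < t) f (k%:R *: alpha) >= t%:R * sigma t].
Proof.
case: n hn alpha halpha => [//|n] _ alpha halpha.
set a := alpha 0 0.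
have a_irr (q : int) : q != 0 -> distZ (q%:~R * a) != 0.
  exact: completely_irrational_distZ_neq0.
have sigma_small m : exists N, forall t, (N <= t)%N -> sigma t <= 2^-1 ^+ m.
  have half_gt0 : 0 < 2^-1 ^+ m :> R by rewrite exprn_gt0.
  have /cvgrPdist_le/(_ _ half_gt0)[N _ HN] := hlim.
  exists N => t /HN /=; rewrite sub0r normrN; exact: le_trans (ler_norm _).
have [N HN] := choice sigma_small.
(* Partial sums of the thresholds, each increased by 1: a strictly increasing
   majorant of [N]. *)
pose K m := (\sum_(i < m.+1) (N i).+1)%N.
have KS m : K m.+1 = (K m + (N m.+1).+1)%N by rewrite /K big_ord_recr.
have K_gt m : (m < K m)%N.
  elim: m => [|m IH]; first by rewrite /K big_ord1.
  by rewrite KS addnS ltnS (leq_trans IH) ?leq_addr.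
have NK m : (N m <= K m)%N.
  by rewrite /K big_ord_recr /= (leq_trans (leqnSn _)) ?leq_addl.
have approx m : exists q : int,
    q != 0 /\ distZ (q%:~R * a) <= (2 * (K m.+1)%:R)^-1.
  have [|q q0 qa] := distZ_approx a_irr (e := (2 * (K m.+1)%:R)^-1).
    by rewrite invr_gt0 mulr_gt0 // ltr0n (leq_ltn_trans _ (K_gt m.+1)).
  by exists q.
have [q Hq] := choice approx.
have [g_cont g_per g_int g_bound g_sum] :=
  coboundary_series a_irr (fun m => (Hq m).1).
move: g_cont g_per g_int g_bound g_sum; set g := fun x => limn _.
move=> g_cont g_per g_int g_bound g_sum.
exists (fun x => g (x 0 0)), (K 0); split.
- move=> x; apply: (@continuous_comp _ _ _ (fun x : 'rV[R]_n.+1 => x 0 0) g).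
    exact: coord_continuous.
  exact: g_cont.
- move=> x i; rewrite !mxE /=; case: eqP => _; first exact: g_per.
  by rewrite addr0.
- rewrite torus_integral_coord0 // -[LHS]fineK; first by congr (_%:E).
  by apply: integrable_fin_num => //; exact: continuous_itv_integrable.
- by move=> x; apply: le_trans (g_bound _) (pi_ge2 R).
- split; first exact: leq_ltn_trans (K_gt 0%N).
  move=> t K0t; have [m /andP[Kmt tKm]] := exists_block K_gt K0t.
  under eq_bigr do rewrite mxE.
  apply: le_trans (g_sum m t _).
    by apply: ler_wpM2l => //; apply: HN; exact: leq_trans (NK m) Kmt.
  (* As [t < K m.+1], the m-th term is still in its linear regime. *)
  apply: le_trans (ler_wpM2l _ (Hq m).2) _ => //.
  rewrite invfM mulrCA -[leRHS]mulr1 ler_pM2l //.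
  by rewrite ler_pdivrMr ?mul1r ?ler_nat ?ltr0n ?(leq_ltn_trans _ tKm) // ltnW.
Qed.
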